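(* There is an absolute constant $c$ such that for every $0<\delta\leq 1$, every $(d,\Delta)$-degenerate graph $H$ with chromatic number $q$ and $n$ vertices satisfies $$r(H) < 2^{c q 3^q d/\delta}\,\Delta^{c\delta}\, n.$$
   Context: The Ramsey number $r(H)$ of a graph $H$ is the least positive integer $N$ such that every two-coloring of the edges of $K_N$ contains a monochromatic copy of $H$. A graph $H$ is $(d,\Delta)$-degenerate if there is an ordering $v_1,\ldots,v_n$ of its vertices such that for each $v_i$: (1) at most $d$ vertices $v_j$ with $j<i$ are adjacent to $v_i$, and (2) there are at most $\Delta$ subsets $S\subset\{v_1,\ldots,v_i\}$ such that $S=N(v_j)\cap\{v_1,\ldots,v_i\}$ for some neighbor $v_j$ of $v_i$ with $j>i$, where $N(v)$ is the set of neighbors of $v$. *)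

(* Defs.v *)
From mathcomp Require Import all_boot.

Set Implicit Arguments.
Unset Strict Implicit.
Unset Printing Implicit Defensive.

Record sgraph := SGraph {
  vertex :> finType;
  adj : rel vertex;
  adj_sym : symmetric adj;
  adj_irr : irreflexive adj }.

Definition neighbors (H : sgraph) (x : H) : {set H} := [set y | adj x y].

Definition colorable (H : sgraph) (k : nat) : bool :=
  [exists f : {ffun H -> 'I_k}, forall x, forall y, adj x y ==> (f x != f y)].

Lemma colorable_ex (H : sgraph) : exists k, colorable H k.
Proof.
exists #|H|; apply/existsP; exists [ffun x => enum_rank x].
apply/forallP=> x; apply/forallP=> y; apply/implyP=> xy; rewrite !ffunE.
by apply: contraTneq xy => /enum_rank_inj ->; rewrite adj_irr.
Qed.

Definition chromatic_number (H : sgraph) : nat := ex_minn (colorable_ex H).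

(* The set {v_1, ..., v_i}, for an ordering v indexed from 0. *)
Definition prefix_set (H : sgraph) (n : nat) (v : 'I_n -> H) (i : 'I_n) :
  {set H} := [set v j | j : 'I_n & (j <= i)%N].

Definition degenerate (d Delta : nat) (H : sgraph) : Prop :=
  exists2 v : 'I_#|H| -> H, bijective v &
    forall i : 'I_#|H|,
      (#|[set j : 'I_#|H| | (j < i)%N && adj (v j) (v i)]| <= d)%N /\
      (#|[set neighbors (v j) :&: prefix_set v i |
            j : 'I_#|H| & (i < j)%N && adj (v i) (v j)]| <= Delta)%N.

(* A two-coloring of the edges of K_N is a map c on sets of vertices, of which
   only the values at two-element sets are ever used: f is injective and adj is
   irreflexive, so [set f x; f y] is always an edge of K_N below. *)
Definition mono_copy (H : sgraph) (N : nat) (c : {ffun {set 'I_N} -> bool}) :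
  bool :=
  [exists b : bool, exists f : {ffun H -> 'I_N}, injectiveb f &&
    [forall x, forall y, adj x y ==> (c [set f x; f y] == b)]].

Definition arrows (N : nat) (H : sgraph) : bool :=
  (0 < N)%N && [forall c : {ffun {set 'I_N} -> bool}, mono_copy H c].

Lemma ramsey_clique (a b : nat) : exists N, forall (T : finType)
    (c : {set T} -> bool) (A : {set T}), (N <= #|A|)%N ->
  exists k (S : {set T}), [/\ S \subset A, #|S| = (if k then a else b) &
    {in S &, forall x y, x != y -> c [set x; y] = k}].
Proof.
have [m] := ubnP (a + b)%N; elim: m a b => // m IHm [|a] [|b] ltm.
- exists 0%N => T c A _; exists true, set0.
  by split=> [||x y]; rewrite ?sub0set ?cards0 ?inE.
- exists 0%N => T c A _; exists true, set0.
  by split=> [||x y]; rewrite ?sub0set ?cards0 ?inE.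
- exists 0%N => T c A _; exists false, set0.
  by split=> [||x y]; rewrite ?sub0set ?cards0 ?inE.
have [|N1 H1] := IHm a b.+1; first by rewrite -ltnS.
have [|N2 H2] := IHm a.+1 b; first by rewrite -ltnS -addnS.
exists (N1 + N2).+1 => T c A leA.
have /card_gt0P[x xA] : (0 < #|A|)%N by exact: leq_trans leA.
pose B k := [set y in A :\ x | c [set x; y] == k].
have cardB : (N1 + N2 <= #|B true| + #|B false|)%N.
  suff -> : (#|B true| + #|B false|)%N = #|A :\ x|.
    by move: leA; rewrite (cardsD1 x) xA.
  rewrite -(cardsID [set y | c [set x; y]] (A :\ x)); congr (_ + _)%N;
    by apply: eq_card => y; rewrite !inE; case: (c _) => //=;
       rewrite ?andbT ?andbF.
have BA k : B k \subset A.
  by apply/subsetP=> y; rewrite !inE => /andP[/andP[]].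
have ext k (S : {set T}) j : S \subset B k -> #|S| = j ->
    {in S &, forall y z, y != z -> c [set y; z] = k} ->
    [/\ x |: S \subset A, #|x |: S| = j.+1 &
    {in x |: S &, forall y z, y != z -> c [set y; z] = k}].
  move=> sSB <- cS; have /subsetP sSB' := sSB; split.
  - by rewrite subUset sub1set xA (subset_trans sSB).
  - by rewrite cardsU1; case: (boolP (x \in S)) => // /sSB'; rewrite !inE eqxx.
  have cx y : y \in S -> c [set x; y] = k.
    by move/sSB'; rewrite inE => /andP[_ /eqP].
  move=> y z /setU1P[->|yS] /setU1P[->|zS]; first by rewrite eqxx.
  - by move=> _; exact: cx.
  - by move=> _; rewrite setUC; exact: cx.
  - exact: cS.
have [le1|lt1] := leqP N1 #|B true|.
  have [[] [S [sS cS hS]]] := H1 T c (B true) le1.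
    by exists true, (x |: S); exact: ext sS cS hS.
  by exists false, S; split=> //; exact: subset_trans sS (BA _).
have le2 : (N2 <= #|B false|)%N.
  rewrite leqNgt; apply/negP => lt2.
  by move: cardB; rewrite leqNgt -addnS leq_add // ltnW.
have [[] [S [sS cS hS]]] := H2 T c (B false) le2.
  by exists true, S; split=> //; exact: subset_trans sS (BA _).
by exists false, (x |: S); exact: ext sS cS hS.
Qed.

Lemma arrows_ex (H : sgraph) : exists N, arrows N H.
Proof.
have [N HN] := ramsey_clique #|H| #|H|.
exists N.+1; apply/andP; split=> //; apply/forallP=> c.
have [|k [S [_ cS hS]]] := HN _ (fun e => c e) [set: 'I_N.+1].
  by rewrite cardsT card_ord.
have {}cS : #|H| = #|S| by case: k {hS} cS.
pose f (x : H) : 'I_N.+1 := enum_val (cast_ord cS (enum_rank x)).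
have finj : injective f by move=> x y /enum_val_inj/cast_ord_inj/enum_rank_inj.
apply/existsP; exists k; apply/existsP; exists (finfun f); apply/andP; split.
  by apply/injectiveP=> x y; rewrite !ffunE => /finj.
apply/forallP=> x; apply/forallP=> y; apply/implyP=> xy; rewrite !ffunE.
apply/eqP/hS; rewrite ?enum_valP //.
by apply: contraTneq xy => /finj ->; rewrite adj_irr.
Qed.

Definition ramsey_number (H : sgraph) : nat := ex_minn (arrows_ex H).

(* Main.v *)
(** Fix a two-colouring of the complete graph. In one colour there are sets
[B_0, ..., B_(q-1)], [q] the chromatic number, such that for every [j] almost
every tuple of vertices drawn from the [B_i], [i != j], has at least
[beta * #|B_j|] common neighbours in [B_j]. Dependent random choice, applied
[2 q] times in a decreasing sequence of sets, first gives a monochromatic chain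
in which this holds for tuples drawn from the sets [B_i] with [i > j] only. The
restriction is removed for [j = q-1, ..., 0] in turn: intersect all [B_i],
[i != j], with the common neighbourhood of a random tuple [T] of [B_j]. A tuple
[S] with few common neighbours in [B_j] survives with probability at most
[beta ^ #|T|], while the other conditions are inherited by applying them to
[T ++ S]. Each step costs tuple length, by a factor below 3, whence the [3 ^ q].

The vertices of [H] are then embedded in the degenerate order, the colour class
of index [i] into [B_i], so that for every vertex still to come the images of
its [s] embedded neighbours extend to a tuple of length [d] with few common
neighbours in at most a fraction [theta ^ (d - s)] of the cases. At each step a
choice of image is forbidden by at most [Delta * q] conditions, each excluding a
fraction [theta] of [B_i]. With [beta = 2 ^ - b] and [b] about [log Delta / r],
[r] about [q / delta], the loss of a factor [beta] in each of the [q] steps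
amounts to [Delta ^ O(delta)]. *)
Require Import Defs.
From HB Require Import structures.
From mathcomp Require Import all_boot all_order all_algebra.
From mathcomp Require Import all_classical all_reals all_analysis.
(* [fintype] and [finset] come last so that their names shadow those of
   [classical_sets]. *)
From mathcomp Require Import ring lra zify fintype finset.

Set Implicit Arguments.
Unset Strict Implicit.
Unset Printing Implicit Defensive.

Import Order.TTheory GRing.Theory Num.Theory.
Local Open Scope ring_scope.

(** * Integrals over sequences *)

Section Mean.
Variables (R : realFieldType) (V : finType).
Implicit Types (w : V -> R) (F G : seq V -> R) (P : pred V) (K : R).

(* The integral of [F] over [n]-tuples for the [n]-th power of the measure [w],
   which need not have total mass 1. *)
Fixpoint mean w n F : R :=
  if n is n'.+1 then \sum_x w x * mean w n' (fun l => F (x :: l)) else F [::].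

Lemma eq_mean w n F G : F =1 G -> mean w n F = mean w n G.
Proof.
elim: n F G => [|n IHn] F G eqFG /=; first exact: eqFG.
by apply: eq_bigr => x _; congr (_ * _); apply: IHn => l; apply: eqFG.
Qed.

Lemma mean_ge0 w n F : (forall x, 0 <= w x) -> (forall l, 0 <= F l) ->
  0 <= mean w n F.
Proof.
move=> w0; elim: n F => [|n IHn] F F0 //=.
by apply: sumr_ge0 => x _; rewrite mulr_ge0 // IHn.
Qed.

Lemma ler_mean w n F G : (forall x, 0 <= w x) -> (forall l, F l <= G l) ->
  mean w n F <= mean w n G.
Proof.
move=> w0; elim: n F G => [|n IHn] F G leFG //=.
by apply: ler_sum => x _; rewrite ler_wpM2l // IHn.
Qed.

Lemma meanZ w n a F : mean w n (fun l => a * F l) = a * mean w n F.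
Proof.
elim: n F => [|n IHn] F //=.
by rewrite mulr_sumr; apply: eq_bigr => x _; rewrite IHn mulrCA.
Qed.

Lemma mean_sum w n (I : Type) (r : seq I) (Q : pred I) (F : I -> seq V -> R) :
  mean w n (fun l => \sum_(i <- r | Q i) F i l) =
  \sum_(i <- r | Q i) mean w n (F i).
Proof.
elim: n F => [|n IHn] F //=.
rewrite exchange_big /=; apply: eq_bigr => x _.
by rewrite IHn mulr_sumr.
Qed.

Lemma meanD w n F G :
  mean w n (fun l => F l + G l) = mean w n F + mean w n G.
Proof.
elim: n F G => [|n IHn] F G //=; rewrite -big_split /=.
by apply: eq_bigr => x _; rewrite IHn mulrDr.
Qed.

Lemma mean_cat w s t F :
  mean w (s + t) F = mean w s (fun T => mean w t (fun S => F (T ++ S))).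
Proof. by elim: s F => [|s IHs] F //=; apply: eq_bigr => x _; rewrite IHs. Qed.

Lemma exchange_mean w w' s t (F : seq V -> seq V -> R) :
  mean w s (fun T => mean w' t (F T)) =
  mean w' t (fun S => mean w s (fun T => F T S)).
Proof.
elim: s F => [|s IHs] F //=.
rewrite mean_sum; apply: eq_bigr => x _.
by rewrite IHs meanZ.
Qed.

Lemma mean_all w n P :
  mean w n (fun l => (all P l)%:R) = (\sum_(x | P x) w x) ^+ n.
Proof.
elim: n => [|n IHn] //=; rewrite exprS -IHn mulr_suml [RHS]big_mkcond /=.
apply: eq_bigr => x _; case: (P x) => //=.
rewrite (@eq_mean _ _ _ (fun=> 0 * 0)) ?meanZ ?mul0r ?mulr0 // => l.
Qed.

Lemma mean_const w n K : mean w n (fun=> K) = (\sum_x w x) ^+ n * K.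
Proof.
rewrite -[RHS]mulrC -(mean_all _ _ predT) -meanZ; apply: eq_mean => l.
by rewrite all_predT mulr1.
Qed.

(** A change of measure costs [K] per entry. As [w] vanishes off [P], the factor [all P l] comes for
    free: tuples of a subset are compared with those tuples of the ambient set that happen to lie in
    it. *)
Lemma ler_mean_weight w w' P K n F : 0 <= K ->
  (forall x, 0 <= w x <= K * (w' x * (P x)%:R)) -> (forall x, 0 <= w' x) ->
  (forall l, 0 <= F l) ->
  mean w n F <= K ^+ n * mean w' n (fun l => (all P l)%:R * F l).
Proof.
move=> K0 ww' w'0; elim: n F => [|n IHn] F F0 /=; first by rewrite expr0 !mul1r.
rewrite mulr_sumr; apply: ler_sum => x _; case/andP: (ww' x) => wx0 wx.
have m0 : 0 <= mean w n (fun l => F (x :: l)).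
  by apply: mean_ge0 => // y; case/andP: (ww' y).
apply: le_trans (ler_wpM2r m0 wx) _.
have -> : mean w' n (fun l => (P x && all P l)%:R * F (x :: l)) =
    (P x)%:R * mean w' n (fun l => (all P l)%:R * F (x :: l)).
  rewrite -meanZ; apply: eq_mean => l; rewrite mulrA.
  by case: (P x); rewrite ?mul1r ?mul0r.
rewrite exprS.
have -> : forall m, K * K ^+ n * (w' x * ((P x)%:R * m)) =
    K * (w' x * (P x)%:R) * (K ^+ n * m) by move=> m; ring.
by rewrite ler_wpM2l ?mulr_ge0 // IHn.
Qed.

Lemma ler_mean_scale w w' K n F : 0 <= K ->
  (forall x, 0 <= w x <= K * w' x) -> (forall x, 0 <= w' x) ->
  (forall l, 0 <= F l) -> mean w n F <= K ^+ n * mean w' n F.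
Proof.
move=> K0 ww' w'0 F0.
rewrite -(@eq_mean w' n (fun l => (all predT l)%:R * F l)); last first.
  by move=> l; rewrite all_predT mul1r.
by apply: ler_mean_weight => // x; rewrite mulr1.
Qed.

Lemma ler_mean_le w w' n F : (forall x, 0 <= w x <= w' x) ->
  (forall l, 0 <= F l) -> mean w n F <= mean w' n F.
Proof.
move=> ww' F0; rewrite -[leRHS]mul1r -(expr1n _ n).
apply: ler_mean_scale => // x; first by rewrite mul1r.
by have /andP[/le_trans le /le] := ww' x.
Qed.

(** The first-moment method. Several demands on one tuple are met at once by packing them into a
    single weighted sum [F]. *)
Lemma mean_lt_ex w n F K : (forall x, 0 <= w x) -> \sum_x w x = 1 ->
  mean w n F < K -> exists l, F l < K.
Proof.
move=> w0 w1; elim: n F => [|n IHn] F /= ltK; first by exists [::].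
have [/existsP[x ltx]|] := boolP [exists x, mean w n (fun l => F (x :: l)) < K].
  by have [l ltl] := IHn _ ltx; exists (x :: l).
rewrite negb_exists => /forallP geK; move: ltK; rewrite ltNge => /negP[].
rewrite -[K]mul1r -w1 mulr_suml; apply: ler_sum => x _.
by rewrite ler_wpM2l // leNgt.
Qed.

Definition unif (A : {set V}) (x : V) : R := (x \in A)%:R / #|A|%:R.

Lemma unif_ge0 (A : {set V}) x : 0 <= unif A x.
Proof. by rewrite divr_ge0 ?ler0n. Qed.

Lemma sum_unif (B A : {set V}) :
  \sum_(x in B) unif A x = #|B :&: A|%:R / #|A|%:R.
Proof.
rewrite -mulr_suml; congr (_ / _).
rewrite -sumr_const big_mkcond [RHS]big_mkcond; apply: eq_bigr => x _.
by rewrite inE; case: (x \in B); case: (x \in A).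
Qed.

Lemma sum_unif1 (A : {set V}) : (0 < #|A|)%N -> \sum_x unif A x = 1.
Proof.
move=> A0; have := sum_unif [set: V] A.
rewrite setTI divff ?pnatr_eq0 -?lt0n // => <-.
by apply: eq_bigl => x; rewrite inE.
Qed.

Lemma unif_sub (A B : {set V}) K x : B \subset A -> (0 < #|A|)%N -> 0 <= K ->
  #|A|%:R <= K * #|B|%:R -> unif B x <= K * unif A x.
Proof.
move=> /subsetP sBA A0 K0 AB; rewrite /unif.
have [xB|_] := boolP (x \in B); last first.
  by rewrite mul0r mulr_ge0 // divr_ge0.
have B0 : (0 < #|B|)%N by apply/card_gt0P; exists x.
rewrite (sBA _ xB) !mul1r -[X in X <= _]mul1r ler_pdivrMr ?ltr0n //.
by rewrite mulrAC ler_pdivlMr ?ltr0n // mul1r.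
Qed.

End Mean.

(** * Common neighbourhoods and dependent random choice *)

Section CommonNeighbours.
Variables (R : realFieldType) (V : finType).
Implicit Types (e : rel V) (A B : {set V}) (S T : seq V) (beta : R).

Definition common e S : {set V} := [set y | all (e y) S].

Definition poor e beta B S : bool := #|common e S :&: B|%:R < beta * #|B|%:R.

Lemma common_cat e S T : common e (S ++ T) = common e S :&: common e T.
Proof. by apply/setP => y; rewrite !inE all_cat. Qed.

Lemma all_common e S T : symmetric e ->
  all [in common e T] S = all [in common e S] T.
Proof.
move=> e_sym; have := allrelC e S T; rewrite /allrel.
rewrite (@eq_all _ _ [in common e T]); last by move=> x; rewrite !inE.
move=> ->; apply: eq_all => x; rewrite !inE /=.
by apply: eq_all => y; rewrite /= e_sym.
Qed.

Lemma poor_cat e beta B S T : 0 <= beta ->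
  poor e beta B T -> poor e beta B (T ++ S).
Proof.
move=> b0; apply: le_lt_trans.
by rewrite ler_nat subset_leq_card // common_cat setSI // subsetIl.
Qed.

Lemma poor_nil e beta B : beta <= 1 -> poor e beta B [::] = false.
Proof.
move=> b1; apply/negbTE; rewrite -leNgt.
have -> : common e [::] = [set: V] by apply/setP => y; rewrite !inE.
by rewrite setTI ler_piMl.
Qed.

Lemma mean_common e s B S : (0 < #|B|)%N ->
  mean (unif R B) s (fun T => (all [in common e S] T)%:R) =
  (#|common e S :&: B|%:R / #|B|%:R) ^+ s.
Proof.
move=> B0; rewrite mean_all; congr (_ ^+ s).
exact: sum_unif.
Qed.

(** By symmetry of [e], [S] lies in the common neighbourhood of [T] exactly when [T] lies in that of
    [S]. The latter has density below [beta] in [B] if [S] is poor, so all [s] independent entries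
    of [T] hit it with probability at most [beta ^+ s]. *)
Lemma mean_poor_common e beta s B S : symmetric e -> (0 < #|B|)%N ->
  0 <= beta ->
  mean (unif R B) s (fun T => (all [in common e T] S)%:R *
    (poor e beta B S)%:R) <= beta ^+ s.
Proof.
move=> e_sym B0 b0; have [/ltW poorS|_] := boolP (poor e beta B S); last first.
  rewrite (@eq_mean _ _ _ _ _ (fun T => 0 * 0)) ?meanZ ?mul0r ?exprn_ge0 //.
  by move=> T; rewrite !mulr0.
rewrite (@eq_mean _ _ _ _ _ (fun T => (all [in common e S] T)%:R)); last first.
  by move=> T; rewrite mulr1 all_common.
rewrite mean_common // lerXn2r ?nnegrE ?divr_ge0 //.
by rewrite ler_pdivrMr ?ltr0n.
Qed.

End CommonNeighbours.

Section ColourClasses.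
Variables (R : realFieldType) (V : finType) (col : {set V} -> bool).
Implicit Types (A : {set V}) (c : bool).

Definition edge c : rel V := fun x y => (x != y) && (col [set x; y] == c).

Lemma edge_sym c : symmetric (edge c).
Proof. by move=> x y; rewrite /edge eq_sym setUC. Qed.

Lemma card_edge A x : x \in A ->
  (#|common (edge true) [:: x] :&: A| + #|common (edge false) [:: x] :&: A|)%N
  = #|A|.-1.
Proof.
move=> xA; rewrite -cardsUI.
have -> : common (edge true) [:: x] :&: A :&:
    (common (edge false) [:: x] :&: A) = set0.
  apply/setP => y; rewrite !inE /= !andbT /edge.
  by case: (y \in A); case: (y == x); case: (col _).
rewrite cards0 addn0 (cardsD1 x A) xA /=; apply: eq_card => y.
rewrite !inE /= !andbT /edge.
by case: (y \in A); case: (y == x); case: (col _).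
Qed.

(* In the denser colour the average degree is at least [#|A| / 4], so at least
   one vertex in eight has degree at least [#|A| / 8]. *)
Lemma dense_colour A : (2 <= #|A|)%N -> exists c,
  #|A|%:R <= 8 * #|[set x in A | #|A|%:R <=
     8 * #|common (edge c) [:: x] :&: A|%:R :> R]|%:R :> R.
Proof.
move=> A2.
pose dg c x := #|common (edge c) [:: x] :&: A|.
pose D c := [set x in A | (#|A| <= 8 * dg c x)%N].
suff [c Dc] : exists c, (#|A| <= 8 * #|D c|)%N.
  exists c; rewrite -natrM ler_nat (leq_trans Dc) // leq_mul //.
  apply/subset_leq_card/subsetP => x; rewrite !inE => /andP[->] /=.
  by rewrite -natrM ler_nat.
have bd c : (8 * \sum_(x in A) dg c x <= 8 * (#|D c| * #|A|) + #|A| * #|A|)%N.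
  have -> : (#|D c| * #|A| = \sum_(x in A) (x \in D c) * #|A|)%N.
    rewrite -big_distrl /=; congr (_ * _)%N.
    rewrite -sum1_card big_mkcond [RHS]big_mkcond; apply: eq_bigr => x _.
    by rewrite inE; case: (x \in A); case: (_ <= _)%N.
  rewrite !big_distrr -sum_nat_const -big_split leq_sum //= => x xA.
  rewrite inE xA /=; case: (leqP #|A|) => [_|/ltnW le]; last first.
    by rewrite mul0n muln0.
  rewrite mul1n (leq_trans _ (leq_addr _ _)) // leq_mul //.
  exact/subset_leq_card/subsetIr.
have tot : (\sum_(x in A) dg true x + \sum_(x in A) dg false x =
    #|A| * #|A|.-1)%N.
  rewrite -big_split /= (eq_bigr (fun=> #|A|.-1)) ?sum_nat_const // => x.
  exact: card_edge.
case: (leqP #|A| (8 * #|D true|)) => [?|l1]; first by exists true.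
case: (leqP #|A| (8 * #|D false|)) => [?|l2]; first by exists false.
(* If neither colour works, the bounds add up to [8 a (a - 1) < 4 a ^ 2], hence [a < 2]. *)
exfalso; move: tot l1 l2 (bd true) (bd false) A2.
set a := #|A|; set x := (\sum_(x in A) _)%N; set y := (\sum_(x in A) _)%N.
set m := #|D _|; set m' := #|D _|; nia.
Qed.

End ColourClasses.

Section DependentRandomChoice.
Variables (R : realFieldType) (V : finType) (col : {set V} -> bool).
Implicit Types (A : {set V}).

(** [A'] consists of the common neighbours in [A] of a random [s]-tuple [T] of [A]. Its expected
    density [Z] is not small, while poor tuples rarely survive in it, as measured by [Y].
    Renormalising from [A] to [A'] costs [K ^+ t]. *)
Lemma dependent_random_choice A (beta : R) s t : (2 <= #|A|)%N -> 0 < beta ->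
  exists c, exists A', [/\ A' \subset A,
    #|A|%:R <= 2 ^+ (3 * s + 5) * #|A'|%:R :> R &
    mean (unif R A') t (fun S => (poor (edge col c) beta A S)%:R) <=
      (2 ^+ (3 * s + 5)) ^+ t.+1 * beta ^+ s].
Proof.
move=> A2 b0; have [c] := dense_colour R col A2.
set D := [set x in A | _] => Dc; pose e := edge col c.
have e_sym : symmetric e := edge_sym col c.
have A0 : (0 < #|A|)%N by apply: ltnW.
have a0 : 0 < #|A|%:R :> R by rewrite ltr0n.
set K : R := 2 ^+ (3 * s + 5); have K0 : 0 < K by rewrite exprn_gt0.
pose Y T := mean (unif R A) t
  (fun S => (all [in common e T] S)%:R * (poor e beta A S)%:R).
pose Z T := mean (unif R A) 1 (fun S => (all [in common e T] S)%:R).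
have ZE T : Z T = #|common e T :&: A|%:R / #|A|%:R.
  by rewrite /Z mean_common ?expr1.
have EY : mean (unif R A) s Y <= beta ^+ s.
  rewrite exchange_mean.
  apply: (@le_trans _ _ (mean (unif R A) t (fun=> beta ^+ s))).
    apply: ler_mean => [x|S]; first exact: unif_ge0.
    by apply: mean_poor_common; rewrite // ltW.
  by rewrite mean_const sum_unif1 // expr1n mul1r.
(* The set [D] has density at least 1/8, and each of its vertices is a common neighbour of [T] with
   probability at least [8^-1 ^+ s]; [K] equals [4 * 8 ^ (s + 1)]. *)
have EZ : 4 / K <= mean (unif R A) s Z.
  rewrite exchange_mean /=.
  apply: (@le_trans _ _ (\sum_(x in D) #|A|%:R^-1 * (8^-1) ^+ s)).
    rewrite sumr_const -[_ *+ #|D|]mulr_natl mulrA.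
    have -> : 4 / K = 8^-1 * 8^-1 ^+ s.
      rewrite /K -exprS exprVn; apply: (canLR (mulfK _)).
        by rewrite gt_eqF.
      have -> : (8 : R) = 2 ^+ 3 by ring.
      rewrite -exprM mulnS exprD (_ : 3 * s + 5 = 2 + 3 + 3 * s)%N; last by lia.
      rewrite !exprD; field; rewrite !expf_neq0 // pnatr_eq0 //.
    rewrite ler_wpM2r ?exprn_ge0 ?invr_ge0 //.
    by rewrite ler_pdivlMr // mulrC ler_pdivrMr // mulrC.
  rewrite [leRHS](bigID (mem D)) /= -[leLHS]addr0 lerD //; last first.
    apply: sumr_ge0 => x _; rewrite mulr_ge0 ?unif_ge0 ?mean_ge0 // => y.
    exact: unif_ge0.
  apply: ler_sum => x; rewrite inE => /andP[xA dx].
  rewrite {1}/unif xA mul1r ler_wpM2l ?invr_ge0 //.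
  rewrite (@eq_mean _ _ _ _ _ (fun T => (all [in common e [:: x]] T)%:R)).
    rewrite mean_common // lerXn2r ?nnegrE ?invr_ge0 ?divr_ge0 //.
    by rewrite ler_pdivlMr // mulrC ler_pdivrMr // mulrC.
  by move=> T; rewrite -all_common.
(* The mean is at most [2 / K - 4 / K]. Since [Y T >= 0] and [Z T <= 1], one such [T] satisfies both
   [Z T >= K^-1] and [Y T <= K * beta ^+ s]. *)
have [T HT] : exists T, 2 / (K * beta ^+ s) * Y T + (-1) * Z T < - K^-1.
  apply: (@mean_lt_ex _ _ (unif R A) s) => [x||].
  - exact: unif_ge0.
  - exact: sum_unif1.
  rewrite meanD !meanZ.
  have : 2 / (K * beta ^+ s) * mean (unif R A) s Y <= 2 / K.
    apply: le_trans (ler_wpM2l _ EY) _.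
      by rewrite divr_ge0 // mulr_ge0 ?exprn_ge0 // ltW.
    by rewrite invfM mulrA divfK // gt_eqF // exprn_gt0.
  have : 0 < K^-1 by rewrite invr_gt0.
  lra.
have Y0 : 0 <= Y T.
  by apply: mean_ge0 => [x|l]; [exact: unif_ge0|rewrite mulr_ge0].
have Z1 : Z T <= 1.
  by rewrite ZE ler_pdivrMr // mul1r ler_nat subset_leq_card ?subsetIr.
have bs0 : 0 < K * beta ^+ s by rewrite mulr_gt0 // exprn_gt0.
have ZK : K^-1 <= Z T.
  have : 0 <= 2 / (K * beta ^+ s) * Y T by rewrite mulr_ge0 // divr_ge0 // ltW.
  lra.
have YK : Y T <= K * beta ^+ s.
  have : 2 / (K * beta ^+ s) * Y T <= 1.
    have : 0 < K^-1 by rewrite invr_gt0.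
    lra.
  rewrite mulrAC ler_pdivrMr // mul1r; lra.
have cA : #|A|%:R <= K * #|common e T :&: A|%:R :> R.
  by move: ZK; rewrite ZE ler_pdivlMr // mulrC ler_pdivrMr // mulrC.
exists c, (common e T :&: A); split=> //; first exact: subsetIr.
apply: (@le_trans _ _ (K ^+ t * Y T)); last first.
  by rewrite exprSr -mulrA ler_wpM2l // exprn_ge0 // ltW.
apply: ler_mean_weight => // [|x|x]; [exact: ltW| |exact: unif_ge0].
rewrite unif_ge0 /=.
have [xT|xT] := boolP (x \in common e T).
  by rewrite mulr1 unif_sub ?subsetIr // ltW.
by rewrite /unif inE (negPf xT) mul0r mulr0 mulr0.
Qed.

End DependentRandomChoice.

(** * Nested chains in one colour *)

Section Chain.
Variables (R : realFieldType) (V : finType) (col : {set V} -> bool).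
Implicit Types (A : {set V}) (B : nat -> {set V}) (P : pred nat) (c : bool).

(** Left unnormalised so as to dominate each [unif R (B i)] with constant 1; the price is a mass of
    up to [q], hence a factor [q ^ t] for [t]-tuples. *)
Definition sum_unif_of q B P (x : V) : R := \sum_(i < q | P i) unif R (B i) x.

Lemma sum_unif_of_ge0 q B P x : 0 <= sum_unif_of q B P x.
Proof. by apply: sumr_ge0 => i _; exact: unif_ge0. Qed.

Definition poor_mean c t (beta : R) B w j : R :=
  mean w t (fun S => (poor (edge col c) beta (B j) S)%:R).

(** Induction on the number of rounds, [len] counting the sets still wanted in each colour.
    Dependent random choice in [A] gives a colour [c] and a set [A'], inside which the rest is
    sought with one set fewer in colour [c]. If the result has colour [c], then [A] is prepended;
    its tuples come from sets of density at least [K ^- m] in [A'], whence the factor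
    [(q K ^ m) ^ t]. *)
Lemma nested_chain m q s t (beta eps : R) (len : bool -> nat) A :
  0 < beta -> (len true + len false <= m)%N -> (forall c, len c <= q)%N ->
  (2 * (2 ^ (3 * s + 5)) ^ m <= #|A|)%N ->
  (q%:R * (2 ^+ (3 * s + 5)) ^+ m) ^+ t *
    ((2 ^+ (3 * s + 5)) ^+ t.+1 * beta ^+ s) <= eps ->
  exists c, exists B, forall j, (j < len c)%N ->
    [/\ B j \subset A,
        #|A|%:R <= (2 ^+ (3 * s + 5)) ^+ m * #|B j|%:R :> R &
        poor_mean c t beta B (sum_unif_of (len c) B (fun i => j < i)%N) j <= eps].
Proof.
set K : R := 2 ^+ (3 * s + 5); set k := (2 ^ (3 * s + 5))%N.
have kK : k%:R = K by rewrite natrX.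
have K1 : 1 <= K by rewrite exprn_ege1 // ler1n.
have K0 : 0 < K by apply: lt_le_trans K1.
have k0 : (0 < k)%N by rewrite expn_gt0.
move=> b0; elim: m len A => [|m IHm] len A lem leq leA leeps.
  by exists true, (fun=> A) => j; move: lem; case: (len true).
have [|len0] := boolP [exists c, len c == 0%N].
  by by case/existsP=> c /eqP lc; exists c, (fun=> A) => j; rewrite lc.
have {}len0 c : (0 < len c)%N.
  by rewrite lt0n; move: len0; rewrite negb_exists => /forallP.
have A2 : (2 <= #|A|)%N.
  by apply: leq_trans leA; rewrite leq_pmulr // expn_gt0 k0.
have [c [A' [sA'A leAA' A'poor]]] := dependent_random_choice col s t A2 b0.
have leA' : (2 * k ^ m <= #|A'|)%N.
  rewrite -(leq_pmul2l k0) mulnCA -expnS (leq_trans leA) //.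
  by rewrite -(ler_nat R) natrM kK.
have A'0 : (0 < #|A'|)%N.
  by apply: leq_trans leA'; rewrite muln_gt0 expn_gt0 k0.
have KS0 : 0 <= K ^+ t.+1 * beta ^+ s by rewrite mulr_ge0 ?exprn_ge0 // ltW.
have {}leeps : (q%:R * K ^+ m) ^+ t * (K ^+ t.+1 * beta ^+ s) <= eps.
  apply: le_trans leeps; rewrite ler_wpM2r // lerXn2r ?nnegrE //.
  - by rewrite mulr_ge0 // exprn_ge0 // ltW.
  - by rewrite mulr_ge0 // exprn_ge0 // ltW.
  by rewrite ler_wpM2l // exprS ler_peMl // exprn_ge0 // ltW.
pose len' d := if d == c then (len c).-1 else len d.
have [||d [B BP]] := IHm len' A' _ _ leA' leeps.
- move: (len0 true) (len0 false) lem; rewrite /len'.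
  by case: (c) => /=; lia.
- by move=> d; rewrite /len'; case: eqP => _ //; exact: leq_trans (leq_pred _) _.
have size_le (C : {set V}) : #|A'|%:R <= K ^+ m * #|C|%:R ->
    #|A|%:R <= K ^+ m.+1 * #|C|%:R.
  move=> leC; apply: le_trans leAA' _.
  by rewrite exprS -mulrA ler_wpM2l // ltW.
have [ecd|necd] := eqVneq d c; last first.
  exists d, B => j; move: (BP j).
  rewrite /len' (negPf necd) => H /H[sB /size_le ? ?].
  by split=> //; apply: subset_trans sB sA'A.
exists c, (fun i => if i is i'.+1 then B i' else A).
move: BP (leq c) (len0 c); rewrite /len' ecd eqxx.
case: (len c) => [//|l] /= BP lq _ [|j].
  move=> _; split=> //.
    by rewrite ler_peMl // exprn_ege1.
  apply: le_trans leeps; rewrite /poor_mean.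
  have unifB i x : (i < l)%N -> unif R (B i) x <= K ^+ m * unif R A' x.
    by case/BP => sB leB _; apply: unif_sub => //; rewrite exprn_ge0 // ltW.
  apply: le_trans (ler_wpM2l _ A'poor); last first.
    by rewrite exprn_ge0 // mulr_ge0 // exprn_ge0 // ltW.
  apply: ler_mean_scale => [|x|x|S] //; last exact: unif_ge0.
    by rewrite mulr_ge0 // exprn_ge0 // ltW.
  rewrite sum_unif_of_ge0 /= /sum_unif_of big_mkcond big_ord_recl /= add0r.
  apply: (@le_trans _ _ (\sum_(i < l) K ^+ m * unif R A' x)).
    by apply: ler_sum => i _; exact: (unifB _ _ (ltn_ord i)).
  rewrite sumr_const card_ord -mulrA -[_ *+ l]mulr_natl.
  rewrite ler_wpM2r ?ler_nat ?(ltnW lq) //.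
  by rewrite mulr_ge0 ?unif_ge0 // exprn_ge0 // ltW.
rewrite ltnS => /BP[sB leB poorB]; split; first exact: subset_trans sB sA'A.
  exact: size_le.
apply: le_trans poorB; rewrite /poor_mean.
apply: ler_mean_le => // x; rewrite sum_unif_of_ge0 /= /sum_unif_of.
by rewrite [leLHS]big_mkcond [leRHS]big_mkcond big_ord_recl /= add0r.
Qed.

End Chain.

(** * From a chain to a symmetric system *)

Section Stage.
Variables (R : realFieldType) (V : finType) (col : {set V} -> bool).
Implicit Types (B : nat -> {set V}) (P : pred nat) (c : bool).

(* The indices [i] whose sets supply the tuples that are required to have many
   common neighbours in [B j], once the sets of index at least [k] have been
   processed. *)
Definition tied (k j i : nat) : bool :=
  if (k <= j)%N then i != j else (j < i)%N.

Lemma poor_mean_ge0 c t (beta : R) B w j : (forall x, 0 <= w x) ->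
  0 <= poor_mean col c t beta B w j.
Proof. by move=> w0; apply: mean_ge0. Qed.

Lemma unif_le_sum_unif_of q B P i x : (i < q)%N -> P i ->
  unif R (B i) x <= sum_unif_of R q B P x.
Proof.
move=> iq Pi; rewrite /sum_unif_of (bigD1 (Ordinal iq)) //= lerDl.
by apply: sumr_ge0 => *; exact: unif_ge0.
Qed.

Lemma mass_sum_unif_of q B P : (forall i, (i < q)%N -> (0 < #|B i|)%N) ->
  \sum_x sum_unif_of R q B P x <= q%:R.
Proof.
move=> B0; rewrite exchange_big /=.
rewrite (eq_bigr (fun=> 1)) => [|i _]; last by rewrite sum_unif1 ?B0.
rewrite sumr_const ler_nat (leq_trans (max_card _)) ?card_ord //.
Qed.

(** [B k] is kept and every other [B j] is cut down to the common neighbours of a random [s]-tuple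
    [T] of [B k]. For [j != k], a tuple [S] poor for the new set makes [T ++ S] poor for the old
    one. For [j = k], all tuples now lie in the common neighbourhood of [T], where poor ones are
    rare. *)
Lemma common_neighbourhood_stage q k s t c B (beta eps eps' : R) : (k < q)%N ->
  0 < beta -> beta <= 1 -> 0 < eps' ->
  (forall j, (j < q)%N -> (0 < #|B j|)%N /\
     poor_mean col c (s + t) beta B (sum_unif_of R q B (tied k.+1 j)) j <= eps) ->
  q%:R * (eps' * eps + beta^-1 ^+ t * eps) +
    beta^-1 ^+ t * (q%:R ^+ t * beta ^+ s) < eps' ->
  exists B', forall j, (j < q)%N -> [/\ (0 < #|B' j|)%N,
    beta * #|B j|%:R <= #|B' j|%:R &
    poor_mean col c t beta B' (sum_unif_of R q B' (tied k j)) j <= eps'].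
Proof.
move=> kq b0 b1 e0 HB small; pose e := edge col c.
have B0 j : (j < q)%N -> (0 < #|B j|)%N by case/HB.
have e_sym : symmetric e := edge_sym col c.
have bi0 : 0 <= beta^-1 by rewrite invr_ge0 ltW.
have bit0 : 0 <= beta^-1 ^+ t by rewrite exprn_ge0.
pose u := unif R (B k); pose w j := sum_unif_of R q B (tied k.+1 j).
pose wk := sum_unif_of R q B (tied k k).
have u0 x : 0 <= u x := unif_ge0 R (B k) x.
have w0 j x : 0 <= w j x by exact: sum_unif_of_ge0.
have wk0 x : 0 <= wk x by exact: sum_unif_of_ge0.
(* Index [k] is tied to every [j != k], on either side, so the entries of [T] count as entries of a
   tuple for [j]. *)
have uw j x : j != k -> 0 <= u x <= w j x.
  move=> jk; rewrite u0 unif_le_sum_unif_of // /tied.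
  by move: jk; case: ltngtP => //; rewrite eq_sym => /ltn_eqF ->.
pose X j T : R := (poor e beta (B j) T)%:R.
pose Y j T := mean (w j) t (fun S => (poor e beta (B j) (T ++ S))%:R).
pose Z T := mean wk t (fun S =>
   (all [in common e T] S)%:R * (poor e beta (B k) S)%:R).
have Y0 j T : 0 <= Y j T by apply: mean_ge0.
have Z0 T : 0 <= Z T by apply: mean_ge0 => // S; rewrite mulr_ge0.
have EY (j : 'I_q) : val j != k -> mean u s (Y j) <= eps.
  move=> jk; apply: le_trans (HB j (ltn_ord j)).2.
  rewrite /poor_mean mean_cat; apply: ler_mean_le => // x; exact: uw.
have EX (j : 'I_q) : val j != k -> mean u s (X j) <= eps.
  move=> jk; apply: le_trans (EY j jk); apply: ler_mean => // T.
  apply: (@le_trans _ _ (mean u t (fun=> X j T))).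
    by rewrite mean_const sum_unif1 ?B0 // expr1n mul1r.
  apply: (@le_trans _ _ (mean (w j) t (fun=> X j T))).
    by apply: ler_mean_le => // x; exact: uw.
  apply: ler_mean => // S; rewrite ler_nat /X.
  by case: (boolP (poor e _ _ T)) => // /(poor_cat S (ltW b0)) ->.
have EZ : mean u s Z <= q%:R ^+ t * beta ^+ s.
  rewrite exchange_mean; apply: (@le_trans _ _ (mean wk t (fun=> beta ^+ s))).
    apply: ler_mean => // S.
    exact: (mean_poor_common _ _ e_sym (B0 _ kq) (ltW b0)).
  rewrite mean_const ler_wpM2r ?exprn_ge0 ?(ltW b0) // lerXn2r ?nnegrE //.
    exact: sumr_ge0.
  exact: mass_sum_unif_of.
(* [X j T] is 0 or 1, so its weight [eps'] makes a total below [eps'] force it to be 0: [T] is rich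
   in [B j], which then shrinks by at most a factor [beta]. *)
have [T] : exists T, (\sum_(j < q | val j != k)
    (eps' * X j T + beta^-1 ^+ t * Y j T)) + beta^-1 ^+ t * Z T < eps'.
  apply: (@mean_lt_ex _ _ u s) => //; first by rewrite sum_unif1 ?B0.
  apply: le_lt_trans small; rewrite meanD mean_sum meanZ.
  apply: lerD; last by rewrite ler_wpM2l.
  apply: (@le_trans _ _
    (\sum_(j < q | val j != k) (eps' * eps + beta^-1 ^+ t * eps))).
    apply: ler_sum => j jk; rewrite meanD !meanZ.
    by rewrite lerD // ler_wpM2l ?EX ?EY // ltW.
  rewrite sumr_const -[_ *+ #|_|]mulr_natl ler_wpM2r //.
    have eps0 : 0 <= eps.
      by apply: le_trans (HB k kq).2; apply: poor_mean_ge0 => x; exact: w0.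
    by rewrite addr_ge0 // mulr_ge0 // ltW.
  by rewrite ler_nat (leq_trans (max_card _)) ?card_ord.
have term0 (j : 'I_q) : 0 <= eps' * X j T + beta^-1 ^+ t * Y j T.
  by rewrite addr_ge0 // mulr_ge0 // ltW.
move=> HT.
have HZ : beta^-1 ^+ t * Z T <= eps'.
  by apply: le_trans (ltW HT); rewrite lerDr sumr_ge0.
have HXY j : (j < q)%N -> j != k ->
    eps' * X j T + beta^-1 ^+ t * Y j T < eps'.
  move=> jq jk; apply: le_lt_trans HT.
  rewrite (bigD1 (Ordinal jq)) //= -addrA lerDl addr_ge0 //.
    exact: sumr_ge0.
  by rewrite mulr_ge0.
have richT j : (j < q)%N -> j != k ->
    beta * #|B j|%:R <= #|common e T :&: B j|%:R :> R.
  move=> jq jk; rewrite leNgt; apply/negP => poorT; have := HXY j jq jk.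
  rewrite /X /poor poorT mulr1 ltNge lerDl => /negP[].
  by rewrite mulr_ge0.
pose B' j := if j == k then B k else common e T :&: B j.
exists B'.
have B'le j : (j < q)%N -> j != k -> #|B j|%:R <= beta^-1 * #|B' j|%:R :> R.
  move=> jq jk; rewrite -ler_pdivrMl ?invr_gt0 // invrK.
  by rewrite /B' (negPf jk) richT.
move=> j jq.
have lejj : beta * #|B j|%:R <= #|B' j|%:R.
  by rewrite /B'; case: eqVneq => [->|/(richT j jq)//]; rewrite ler_piMl.
split=> //.
  rewrite -(ltr_nat R); apply: lt_le_trans lejj.
  by rewrite mulr_gt0 // ltr0n B0.
have unifB' i x : (i < q)%N -> unif R (B' i) x <= beta^-1 * unif R (B i) x.
  move=> iq; have [ik|ik] := eqVneq i k.
    by rewrite /B' ik eqxx ler_peMl ?unif_ge0 // invf_ge1.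
  apply: unif_sub; rewrite ?B0 ?B'le //.
  by rewrite /B' (negPf ik) subsetIr.
have [jk|jk] := eqVneq j k.
  apply: le_trans HZ; rewrite /poor_mean jk {2}/B' eqxx.
  apply: ler_mean_weight => // x; rewrite sum_unif_of_ge0 /=.
  have [xT|xT] := boolP (x \in common e T).
    by rewrite mulr1 mulr_sumr; apply: ler_sum => i _; exact: unifB'.
  rewrite mulr0 mulr0 /sum_unif_of big1 // => i.
  rewrite /tied leqnn => ik.
  by rewrite /unif /B' (negPf ik) inE (negPf xT) mul0r.
apply: le_trans (_ : beta^-1 ^+ t * Y j T <= eps'); last first.
  apply: le_trans (ltW (HXY j jq jk)); rewrite lerDr mulr_ge0 //; exact: ltW.
have tiedE : tied k j =1 tied k.+1 j.
  by move=> i; rewrite /tied [(k < j)%N]ltn_neqAle (eq_sym k) jk.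
apply: (@le_trans _ _ (beta^-1 ^+ t * poor_mean col c t beta B' (w j) j)).
  apply: ler_mean_scale => // x; rewrite sum_unif_of_ge0 /=.
  rewrite mulr_sumr /sum_unif_of.
  rewrite (eq_bigl (fun i : 'I_q => tied k.+1 j i)) => [|i]; last exact: tiedE.
  by apply: ler_sum => i _; exact: unifB'.
rewrite ler_wpM2l //; apply: ler_mean => // S; rewrite ler_nat.
case: (boolP (poor e _ (B' j) S)) => // poorS.
suff -> : poor e beta (B j) (T ++ S) by [].
rewrite /poor common_cat; apply: le_lt_trans (lt_le_trans poorS _).
  by rewrite ler_nat /B' (negPf jk) -setIA setICA.
rewrite ler_wpM2l ?(ltW b0) // ler_nat /B' (negPf jk).
by rewrite subset_leq_card ?subsetIr.
Qed.
End Stage.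

(* The tuple length and the exponent of the admitted fraction [beta ^ e] of poor
   tuples that have to hold before [k] stages to be left with [(d, e)] after
   them; the growth rate is the largest eigenvalue [(3 + sqrt 5) / 2] of
   [[2, 1], [1, 1]], and [8 / 3 < 3] bounds it. *)
Definition stage_params (d e k : nat) : nat * nat :=
  iter k (fun p => (p.2 + p.1 + 1 + p.1, p.2 + p.1 + 1))%N (d, e).

Lemma leq_stage_params d e k l : (k <= l)%N ->
  ((stage_params d e k).1 <= (stage_params d e l).1)%N /\
  ((stage_params d e k).2 <= (stage_params d e l).2)%N.
Proof.
move=> /subnKC <-; elim: (l - k)%N => [|m [IH1 IH2]]; first by rewrite addn0.
by rewrite addnS /=; split; lia.
Qed.

Section System.
Variables (R : realFieldType) (V : finType) (col : {set V} -> bool).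
Implicit Types (B : nat -> {set V}) (c : bool).

Lemma iter_stage b q d e k c B : let: beta := (2 ^+ b)^-1 : R in
  (k <= q)%N -> (q.*2 + q ^ (stage_params d e q).1 < 2 ^ b)%N -> (0 < q)%N ->
  (forall j, (j < q)%N -> (0 < #|B j|)%N /\
     poor_mean col c (stage_params d e k).1 beta B
       (sum_unif_of R q B (tied k j)) j <= beta ^+ (stage_params d e k).2) ->
  exists B', forall j, (j < q)%N -> [/\ (0 < #|B' j|)%N,
    beta ^+ k * #|B j|%:R <= #|B' j|%:R &
    poor_mean col c d beta B' (sum_unif_of R q B' (tied 0 j)) j <= beta ^+ e].
Proof.
set beta := (2 ^+ b)^-1 => + bq q0.
have p2 : 0 < 2 ^+ b :> R by rewrite exprn_gt0.
have b0 : 0 < beta by rewrite invr_gt0.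
have b1 : beta <= 1 by rewrite invf_le1 // exprn_ege1 // ler1n.
elim: k B => [|k IHk] B kq HB.
  by exists B => j /HB[? ?]; rewrite expr0 mul1r.
set t := (stage_params d e k).1 in HB *.
set e' := (stage_params d e k).2 in HB *.
(* With [eps = beta ^+ (e' + t + 1)], a spare factor [beta] survives the loss of [beta^-1 ^+ t] and
   beats [q.*2 + q ^ t]. *)
have [||B1 HB1] := @common_neighbourhood_stage R V col q k (e' + t + 1) t c B
    beta   (beta ^+ (e' + t + 1)) (beta ^+ e') kq b0 b1 _ HB.
- by rewrite exprn_gt0.
- have -> : (e' + t + 1 = t + (e' + 1))%N by lia.
  have bt : beta^-1 ^+ t * beta ^+ (t + (e' + 1)) = beta * beta ^+ e'.
    by rewrite exprD mulrA -exprMn mulVf ?gt_eqF // expr1n mul1r addn1 exprS.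
  rewrite (mulrCA _ (q%:R ^+ t)) bt.
  have -> : q%:R * (beta ^+ e' * beta ^+ (t + (e' + 1)) + beta * beta ^+ e') +
      q%:R ^+ t * (beta * beta ^+ e') =
      beta ^+ e' * (q%:R * (beta ^+ (t + (e' + 1)) + beta) + q%:R ^+ t * beta).
    by ring.
  rewrite -[ltRHS]mulr1 ltr_pM2l ?exprn_gt0 //.
  have le1 : beta ^+ (t + (e' + 1)) <= beta.
    by rewrite addnA addn1 exprS ler_piMr ?exprn_ile1 // ltW.
  apply: (@le_lt_trans _ _ ((q.*2 + q ^ t)%:R * beta)).
    rewrite natrD natrX -addnn natrD !mulrDl lerD2r mulrDr lerD2r.
    by rewrite ler_wpM2l.
  rewrite ltr_pdivrMr // mul1r -natrX ltr_nat; apply: leq_ltn_trans bq.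
  rewrite leq_add2l leq_pexp2l //.
  by have [] := leq_stage_params d e (ltnW kq).
have [j /HB1[]|B' HB'] := IHk B1 (ltnW kq); first by [].
exists B' => j jq; have [? le2 ?] := HB' j jq; have [_ le1 _] := HB1 j jq.
split=> //; apply: le_trans le2.
by rewrite exprSr -mulrA ler_wpM2l // exprn_ge0 // ltW.
Qed.

Lemma good_system b q d e : let: beta := (2 ^+ b)^-1 : R in
  let: K := (2 ^ (6 * (stage_params d e q).2 + 5))%N in
  (0 < q)%N -> (0 < d)%N -> (0 < e)%N ->
  (45 * q * (stage_params d e q).1 <= b)%N ->
  (2 * K ^ q.*2 <= #|V|)%N ->
  exists c B, forall j, (j < q)%N ->
    (#|V| <= K ^ q.*2 * 2 ^ (b * q) * #|B j|)%N /\
    poor_mean col c d beta B (sum_unif_of R q B (fun i => i != j)) j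
      <= beta ^+ e.
Proof.
set beta := (2 ^+ b)^-1; set t := (_.1); set E := (_.2) => q0 d0 e0 bq leV.
have [/(leq_trans d0) t0 /(leq_trans e0) E0] := leq_stage_params d e (leq0n q).
have p2 : 0 < 2 ^+ b :> R by rewrite exprn_gt0.
have b0 : 0 < beta by rewrite invr_gt0.
have qt1 : (0 < q * t)%N by rewrite muln_gt0 q0.
have q2 : (q <= 2 ^ q)%N by rewrite ltnW // ltn_expl.
have small : (q.*2 + q ^ t < 2 ^ b)%N.
  apply: (@leq_ltn_trans (2 ^ (q + 1) + 2 ^ (q * t))).
    by rewrite leq_add ?expnM ?leq_exp2r // addn1 expnS mul2n leq_double.
  apply: (@leq_ltn_trans (2 ^ (q + q * t + 1))%N).
    rewrite addnAC (expnD _ (q + 1)).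
    have : (4 <= 2 ^ (q + 1))%N.
      by rewrite -[4%N]/(2 ^ 2)%N leq_exp2l // addn1 ltnS.
    have : (2 <= 2 ^ (q * t))%N by rewrite -{1}[2%N]expn1 leq_exp2l.
    move: (2 ^ (q + 1))%N (2 ^ (q * t))%N => x y; nia.
  by rewrite ltn_exp2l //; nia.
have [|//|||c [B HB]] := @nested_chain R V col q.*2 q (2 * E) t beta (beta ^+ E)
    (fun=> q) [set: V] b0.
- by rewrite addnn.
- by rewrite cardsT (_ : 3 * (2 * E) = 6 * E)%N //; lia.
- set K : R := 2 ^+ _.
  have -> : K = 2 ^+ (6 * E + 5) by congr (_ ^+ _); lia.
  apply: (@le_trans _ _ (((2 ^+ q) * ((2 ^+ (6 * E + 5)) ^+ q.*2)) ^+ t *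
     ((2 ^+ (6 * E + 5)) ^+ t.+1 * beta ^+ (2 * E)))).
    rewrite ler_wpM2r ?mulr_ge0 ?exprn_ge0 ?(ltW b0) //.
    rewrite lerXn2r ?nnegrE ?mulr_ge0 ?exprn_ge0 //.
    by rewrite ler_wpM2r ?exprn_ge0 // -natrX ler_nat.
  (* One half of the exponent [2 * E] absorbs the powers of 2, whose exponent
     [q t + (6 E + 5) (2 q t + t + 1)] is at most [45 q t E]: the coefficients add up to 45. *)
  rewrite (_ : beta ^+ (2 * E) = beta ^+ E * beta ^+ E); last first.
    by rewrite -exprD addnn mul2n.
  rewrite !mulrA ler_piMl ?exprn_ge0 ?(ltW b0) //.
  rewrite /beta exprVn ler_pdivrMr ?exprn_gt0 // mul1r.
  rewrite -!exprM -!exprD -!exprM -exprD ler_eXn2l ?ltr1n //.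
  by nia.
(* For [i, j < q], [tied q j i] means [j < i], which is what the chain provides. *)
have [//|B' HB'] := @iter_stage b q d e q c B (leqnn q) small q0.
  move=> j jq; have [_ leB poorB] := HB j jq; split.
    rewrite lt0n; apply/negP => /eqP B0; move: leB.
    rewrite B0 mulr0 lern0 cardsT => V0; move: leV.
    by rewrite (eqP V0) leqn0 muln_eq0 /= expn_eq0 expn_eq0.
  apply: le_trans poorB; apply: ler_mean_le => // x; rewrite sum_unif_of_ge0 /=.
  rewrite le_eqVlt; apply/orP; left; apply/eqP/eq_bigl => i.
  by rewrite /tied leqNgt jq.
exists c, B' => j jq; have [_ leB' poorB'] := HB' j jq.
have [_ leB _] := HB j jq.
split=> //; rewrite -(ler_nat R) !natrM !natrX -cardsT -mulrA.
apply: le_trans leB _.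
have -> : (3 * (2 * E) + 5 = 6 * E + 5)%N by lia.
rewrite ler_wpM2l ?exprn_ge0 //.
by move: leB'; rewrite exprVn -exprM mulrC ler_pdivrMr ?exprn_gt0 // mulrC.
Qed.
End System.

(** * Embedding degenerate graphs *)

(** Indexing by naturals, with an arbitrary value beyond the last vertex, suits the induction on the
    number of embedded vertices. *)
Lemma degenerate_nat_order d Delta (H : sgraph) : (0 < #|H|)%N ->
  degenerate d Delta H -> exists v : nat -> H,
  [/\ {in gtn #|H| &, injective v},
      forall x, exists2 i, (i < #|H|)%N & v i = x,
      forall i, (i < #|H|)%N ->
        (count (fun j => adj (v j) (v i)) (iota 0 i) <= d)%N &
      forall i, (i < #|H|)%N -> exists2 Xs : {set {set H}}, (#|Xs| <= Delta)%N &
        forall j, (i < j < #|H|)%N -> adj (v i) (v j) ->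
          exists2 X, X \in Xs &
            forall l, (l <= i)%N -> (v l \in X) = adj (v l) (v j)].
Proof.
move=> n0 [v v_bij Hv]; have i0 := Ordinal n0.
pose v' i := v (odflt i0 (insub i)).
have v'E i (lt_i : (i < #|H|)%N) : v' i = v (Ordinal lt_i).
  by rewrite /v' insubT.
exists v'; split.
- move=> i j; rewrite !inE => lti ltj; rewrite !v'E => /(bij_inj v_bij).
  by case.
- move=> x; have [w vK wK] := v_bij; exists (w x) => //.
  by rewrite v'E -[RHS]wK; congr v; apply: val_inj.
- move=> i lti; have [le _] := Hv (Ordinal lti); apply: leq_trans le.
  rewrite cardE -(size_map val) -size_filter uniq_leq_size //.
    by rewrite filter_uniq ?iota_uniq.
  move=> j; rewrite mem_filter mem_iota /= => /andP[adj_ji ltji].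
  have ltj := ltn_trans ltji lti; apply/mapP; exists (Ordinal ltj) => //.
  by rewrite mem_enum inE /= ltji -!v'E.
move=> i lti; have [_] := Hv (Ordinal lti).
set Xs := [set _ | _ in _] => leXs; exists Xs => // j /andP[ltij ltj] adj_ij.
exists (neighbors (v (Ordinal ltj)) :&: prefix_set v (Ordinal lti)).
  by apply/imsetP; exists (Ordinal ltj); rewrite // inE /= ltij -!v'E.
move=> l leli; have ltl := leq_ltn_trans leli lti.
rewrite !v'E !inE adj_sym; apply/andb_idr => _; apply/imsetP.
by exists (Ordinal ltl) => //; rewrite inE.
Qed.

Lemma leq_card_bigcup (I T : finType) (P : {set I}) (F : I -> {set T}) :
  (#|\bigcup_(i in P) F i| <= \sum_(i in P) #|F i|)%N.
Proof.
elim/big_rec2: _ => [|i A m _ le]; first by rewrite cards0.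
by rewrite (leq_trans (leq_card_setU _ _)) ?leq_add2l.
Qed.

Section Embedding.
Variables (R : realFieldType) (V : finType) (col : {set V} -> bool).

Lemma embed_degenerate d Delta q (H : sgraph) (f : H -> 'I_q)
    (B : nat -> {set V}) (beta theta : R) c :
  0 < beta -> beta <= 1 -> 0 < theta -> theta <= 1 ->
  2 * (Delta * q)%:R * theta <= beta ->
  (0 < #|H|)%N -> degenerate d Delta H ->
  (forall x y, adj x y -> f x != f y) ->
  (forall j, (j < q)%N -> 2 * #|H|%:R <= beta * #|B j|%:R) ->
  (forall j, (j < q)%N -> poor_mean col c d beta B
     (sum_unif_of R q B (fun i => i != j)) j < theta ^+ d) ->
  exists2 g : H -> V, injective g &
    forall x y, adj x y -> edge col c (g x) (g y).
Proof.
move=> b0 b1 h0 h1 hD n0 degH fP Bbig Bpoor; pose e := edge col c.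
have e_sym : symmetric e := edge_sym col c.
have [v [v_inj v_surj v_deg v_nbr]] := degenerate_nat_order n0 degH.
set n := #|H| in n0 Bbig v_inj v_surj v_deg v_nbr.
pose wt (k : nat) := sum_unif_of R q B (fun i => i != k).
have wt0 k x : 0 <= wt k x by exact: sum_unif_of_ge0.
have B0 (k : 'I_q) : (0 < #|B k|)%N.
  rewrite -(ltr_nat R) -(pmulr_rgt0 _ b0).
  apply: lt_le_trans (Bbig _ (ltn_ord k)).
  by rewrite mulr_gt0 // ltr0n.
(* [S] stands for the images of the embedded neighbours of a vertex of class [k], and [Y] fills the
   slots left up to length [d]. *)
pose good (k : nat) S := mean (wt k) (d - size S)
  (fun Y => (poor e beta (B k) (S ++ Y))%:R) < theta ^+ (d - size S).
pose sq (g : nat -> V) (X : {set H}) m := [seq g i | i <- iota 0 m & v i \in X].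
have sqS g X m : sq g X m.+1 =
    if v m \in X then rcons (sq g X m) (g m) else sq g X m.
  rewrite /sq -addn1 iotaD add0n filter_cat map_cat /=.
  by case: ifP => _; rewrite ?cats1 ?cats0.
have eq_sq g g' (X X' : {set H}) m : (forall i, (i < m)%N -> g i = g' i) ->
    (forall i, (i < m)%N -> (v i \in X) = (v i \in X')) ->
    sq g X m = sq g' X' m.
  move=> eg eX; rewrite /sq (@eq_in_filter _ _ (fun i => v i \in X')).
    by apply/eq_in_map => i; rewrite mem_filter mem_iota => /and3P[_ _ /eg].
  by move=> i; rewrite mem_iota => /andP[_ /eX].
have size_sq g j m : (m <= j < n)%N -> (size (sq g (neighbors (v j)) m) <= d)%N.
  case/andP=> lemj ltj; apply: leq_trans (v_deg j ltj).
  rewrite /sq size_map size_filter -(subnKC lemj) iotaD count_cat.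
  rewrite (@eq_count _ _ (fun i => adj (v i) (v j))) ?subnKC ?leq_addr // => i.
  by rewrite inE adj_sym.
(* Every extension of a poor [S] is poor, and an index [i != k] gives the measure mass at least 1,
   so the mean would be at least 1. *)
have good_rich (k : 'I_q) S : good k S ->
    (S = [::] \/ exists i : 'I_q, i != k) -> ~~ poor e beta (B k) S.
  move=> goodS SP; apply/negP => poorS; case: SP => [S0|[i ik]].
    by move: poorS; rewrite S0 poor_nil.
  move: goodS; rewrite /good ltNge => /negP[]; apply: (@le_trans _ _ 1).
    by rewrite exprn_ile1 // ltW.
  rewrite (@eq_mean _ _ _ _ _ (fun=> 1)); last first.
    by move=> Y; rewrite poor_cat // ltW.
  rewrite mean_const mulr1 exprn_ege1 // -(sum_unif1 R (B0 i)).
  by apply: ler_sum => x _; exact: unif_le_sum_unif_of.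
(* Markov's inequality: each bad [x] contributes a mean of at least [theta ^+ D] to a total below
   [theta ^+ D.+1]. *)
have few_bad (k k' : 'I_q) S : k' != k -> (size S < d)%N -> good k S ->
    #|[set x in B k' | ~~ good k (rcons S x)]|%:R <= theta * #|B k'|%:R :> R.
  move=> kk' ltSd; set NG := [set x in _ | _].
  rewrite /good -(ltn_predK (_ : 0 < d - size S)%N) ?subn_gt0 //=.
  set D := (d - size S).-1; move/ltW; rewrite exprS => le.
  have hD0 : 0 < theta ^+ D by rewrite exprn_gt0.
  rewrite -ler_pdivrMr ?ltr0n // -(ler_pM2r hD0); apply: le_trans le.
  rewrite (_ : #|NG|%:R / _ = \sum_(x in NG) unif R (B k') x); last first.
    rewrite sum_unif; congr (#|pred_of_set _|%:R / _).
    by apply/esym/setIidPl/subsetP => x; rewrite inE => /andP[].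
  rewrite mulr_suml big_mkcond; apply: ler_sum => x _.
  have m0 : 0 <= mean (wt k) D (fun Y => (poor e beta (B k) (S ++ x :: Y))%:R).
    exact: mean_ge0.
  case: ifP => [|_]; last by rewrite mulr_ge0.
  rewrite inE => /andP[xB]; rewrite /good size_rcons subnS -/D -leNgt => le.
  apply: ler_pM; rewrite ?unif_ge0 ?(ltW hD0) ?unif_le_sum_unif_of //.
  apply: le_trans le _; rewrite le_eqVlt; apply/orP; left; apply/eqP.
  by apply: eq_mean => Y; rewrite cat_rcons.
have main m : (m <= n)%N -> exists g : nat -> V,
    [/\ {in gtn m &, injective g},
        forall i j, (i < m)%N -> (j < m)%N -> adj (v i) (v j) -> e (g i) (g j) &
        forall j, (m <= j < n)%N -> good (f (v j)) (sq g (neighbors (v j)) m)].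
  elim: m => [_|m IHm ltmn].
    have [x _] : exists x, x \in B (f (v 0)) by apply/card_gt0P.
    exists (fun=> x); split=> // j _.
    by rewrite /good /= subn0; apply: Bpoor.
  have [g [g_inj g_adj g_good]] := IHm (ltnW ltmn).
  set c0 := f (v m); set S0 := sq g (neighbors (v m)) m.
  have rich : ~~ poor e beta (B c0) S0.
    apply: good_rich; first by apply: g_good; rewrite leqnn.
    case S0E : S0 => [|y s]; [by left | right].
    have : y \in S0 by rewrite S0E mem_head.
    case/mapP=> i; rewrite mem_filter inE => /andP[adj_mi _] _.
    by exists (f (v i)); rewrite eq_sym fP.
  have [Xs leXs XsP] := v_nbr m ltmn.
  (* The sequence [sq g X m], hence the condition on the image of [v m], depends
     only on the trace [X] of a later neighbourhood: this is what [Delta]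
     counts. *)
  pose P := [set p : {set H} * 'I_q | [&& p.1 \in Xs, p.2 != c0,
     (size (sq g p.1 m) < d)%N & good p.2 (sq g p.1 m)]].
  pose NG (p : {set H} * 'I_q) :=
    [set x in B c0 | ~~ good p.2 (rcons (sq g p.1 m) x)].
  pose used := [set g (val i) | i : 'I_m].
  (* There are at least [beta * #|B c0|] candidates. Fewer than half are used, as [m < n], and at
     most half are forbidden, by the bound on [theta]. *)
  have [x xP] : exists x, x \in (common e S0 :&: B c0) :\:
      (used :|: \bigcup_(p in P) NG p).
    apply/card_gt0P; rewrite lt0n cards_eq0 setD_eq0; apply/negP.
    move=> /subset_leq_card/leq_trans/(_ (leq_card_setU _ _)) leC.
    have cused : (#|used| <= m)%N.
      by rewrite (leq_trans (leq_imset_card _ _)) // card_ord.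
    have cP : (#|P| <= Delta * q)%N.
      apply: (@leq_trans #|setX Xs [set: 'I_q]|).
        apply/subset_leq_card/subsetP => p; rewrite !inE andbT.
        by case/and4P.
      by rewrite cardsX cardsT card_ord leq_mul2r leXs orbT.
    have cNG : #|\bigcup_(p in P) NG p|%:R <=
        (Delta * q)%:R * (theta * #|B c0|%:R) :> R.
      apply: (@le_trans _ _ (\sum_(p in P) #|NG p|)%:R).
        by rewrite ler_nat leq_card_bigcup.
      rewrite natr_sum.
      apply: (@le_trans _ _ (\sum_(p in P) theta * #|B c0|%:R)).
        apply: ler_sum => p; rewrite inE => /and4P[_ pc0 ltd goodp].
        by apply: few_bad; rewrite // eq_sym.
      rewrite sumr_const -[_ *+ #|P|]mulr_natl ler_wpM2r ?ler_nat //.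
      by rewrite mulr_ge0 // ltW.
    have c2 := ler_wpM2r (ler0n R #|B c0|) hD; rewrite -!mulrA in c2.
    have arith (C u N y z m' n' : R) : z <= C -> C <= u + N -> N <= y ->
      2 * y <= z -> u <= m' -> m' + 1 <= n' -> 2 * n' <= z -> False.
      by clear; lra.
    apply: (arith _ #|used|%:R _ _ _ m%:R n%:R _ _ cNG c2 _ _
      (Bbig _ (ltn_ord c0))).
    - by rewrite leNgt; exact: rich.
    - by rewrite -natrD ler_nat.
    - by rewrite ler_nat.
    - by rewrite natr1 ler_nat.
  move: xP; rewrite !inE negb_or => /andP[/andP[x_used x_good] /andP[xS0 xB]].
  have [g' gm gE] : exists2 g', g' m = x & forall i, (i < m)%N -> g' i = g i.
    exists (fun i => if i == m then x else g i); first by rewrite eqxx.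
    by move=> i ltim; rewrite (ltn_eqF ltim).
  have ltSP i : (i < m.+1)%N -> i = m \/ (i < m)%N.
    by rewrite ltnS leq_eqVlt => /predU1P.
  exists g'.
  have x_new i : (i < m)%N -> x != g i.
    move=> ltim; apply: contraNneq x_used => ->.
    by apply/imsetP; exists (Ordinal ltim).
  have x_adj i : (i < m)%N -> adj (v m) (v i) -> e x (g i).
    move=> ltim adj_mi; move/allP: xS0; apply; apply/mapP; exists i => //.
    by rewrite mem_filter mem_iota inE adj_mi.
  split.
  - move=> i j; rewrite !inE => /ltSP[->|lti] /ltSP[->|ltj] //.
    + by rewrite gm gE // => /eqP; rewrite (negPf (x_new _ ltj)).
    + by rewrite gm gE // => /esym/eqP; rewrite (negPf (x_new _ lti)).
    + by rewrite !gE //; exact: g_inj.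
  - move=> i j /ltSP[->|lti] /ltSP[->|ltj].
    + by rewrite adj_irr.
    + by rewrite gm gE //; exact: x_adj.
    + by rewrite gm gE // adj_sym e_sym; exact: x_adj.
    + by rewrite !gE //; exact: g_adj.
  move=> j /andP[ltmj ltjn]; rewrite sqS gm.
  rewrite (eq_sq _ g _ (neighbors (v j)) m) //.
  have goodj : good (f (v j)) (sq g (neighbors (v j)) m).
    by apply: g_good; rewrite (ltnW ltmj).
  have [adj_jm|//] := boolP (v m \in neighbors (v j)).
  have adj_mj : adj (v m) (v j) by move: adj_jm; rewrite inE adj_sym.
  have [|X XXs XE] := XsP j _ adj_mj; first by rewrite ltmj.
  have sqX : sq g X m = sq g (neighbors (v j)) m.
    by apply: eq_sq => // i ltim; rewrite XE ?(ltnW ltim) // inE adj_sym.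
  apply: contraNT x_good => x_bad; apply/bigcupP; exists (X, f (v j)).
    rewrite inE XXs /= sqX goodj andbT eq_sym fP //=.
    (* The bound at [m.+1] already counts [v m], so fewer than [d] images precede [x]. *)
    have := size_sq g j m.+1; rewrite ltmj ltjn sqS adj_jm size_rcons.
    exact.
  by rewrite inE xB /= sqX.
have [g [g_inj g_adj _]] := main n (leqnn n).
have [idx idx_lt idxK] := fin_all_exists2 v_surj.
exists (fun x => g (idx x)).
  move=> x y /g_inj; rewrite !inE => /(_ (idx_lt x) (idx_lt y)) xy.
  by rewrite -(idxK x) xy.
by move=> x y xy; apply: g_adj; rewrite ?idxK.
Qed.

End Embedding.

Lemma ramsey_number_leq (H : sgraph) d Delta q r b :
  let p := stage_params d ((r + 2) * d + 1) q in
  (0 < d)%N -> (0 < q)%N -> (0 < #|H|)%N -> degenerate d Delta H ->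
  colorable H q -> (Delta <= 2 ^ (b * r))%N -> (45 * q * p.1 <= b)%N ->
  (ramsey_number H <=
     2 ^ ((6 * p.2 + 5) * q.*2 + b * q + b + 1) * #|H|)%N.
Proof.
set e := ((r + 2) * d + 1)%N => p d0 q0 n0 degH /existsP[f /forallP fP] leD leb.
(* In the exponent, the first term pays for the [2 q] rounds of the chain, [b * q] for the stages,
   and [b + 1] for [2 * #|H| <= beta * #|B j|]. *)
set N := (_ * #|H|)%N; pose R : realFieldType := rat.
have N0 : (0 < N)%N by rewrite muln_gt0 expn_gt0.
have [td _] := leq_stage_params d e (leq0n q).
have bq : (q < b)%N by move: leb td; rewrite -/p /=; nia.
have b0 : (0 < b)%N by apply: leq_ltn_trans bq.
suff arrowsH : arrows N H by rewrite /ramsey_number; case: ex_minnP => m _ ->.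
rewrite /arrows N0 /=; apply/forallP => col.
have [||//|//||c [B HB]] := @good_system R 'I_N (fun S => col S) b q d e.
- by [].
- by [].
- by rewrite /e addn1.
- rewrite card_ord /N -/p -expnM -[X in (X * _ <= _)%N]/(2 ^ 1)%N -expnD.
  by rewrite -[X in (X <= _)%N]muln1 leq_mul // leq_exp2l // -/p; lia.
(* [theta] is [beta ^+ (r + 2)]: [r] factors offset [Delta], one offsets [2 q], and one is left as
   [beta]. The [+ 1] in [e] makes [beta ^+ e < theta ^+ d] strict. *)
pose beta : R := (2 ^+ b)^-1; pose theta : R := (2 ^+ (b * r + b.*2))^-1.
have fE x y : adj x y -> f x != f y.
  by move=> xy; have /forallP/(_ y)/implyP := fP x; apply.
have [|||||j jq|j jq|g g_inj g_adj] := @embed_degenerate R _ (fun S => col S)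
   d Delta q H f B beta theta c _ _ _ _ _ n0 degH fE.
- by rewrite invr_gt0 exprn_gt0.
- by rewrite invf_le1 ?exprn_gt0 // exprn_ege1 // ler1n.
- by rewrite invr_gt0 exprn_gt0.
- by rewrite invf_le1 ?exprn_gt0 // exprn_ege1 // ler1n.
- rewrite ler_pdivrMr ?exprn_gt0 // [leRHS]mulrC ler_pdivlMr ?exprn_gt0 //.
  rewrite -!natrX -!natrM ler_nat.
  have qb : (2 * q <= 2 ^ b)%N.
    have : (q < 2 ^ q)%N by rewrite ltn_expl.
    rewrite -(prednK b0) expnS leq_mul2l /=; move/ltnW/leq_trans; apply.
    by rewrite leq_exp2l // -ltnS prednK.
  rewrite (_ : b * r + b.*2 = b * r + b + b)%N; last by rewrite -addnn addnA.
  by rewrite !expnD mulnCA -mulnA -[leqRHS]mulnA !leq_mul.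
- have [leV _] := HB j jq.
  rewrite [leRHS]mulrC ler_pdivlMr ?exprn_gt0 // -natrX -!natrM ler_nat.
  move: leV; rewrite card_ord; move: #|B j| => m.
  rewrite /N -expnM -[(_ + 1)%N]addnA expnD expnD -mulnA.
  rewrite leq_pmul2l ?muln_gt0 ?expn_gt0 //.
  by rewrite addn1 expnS mulnAC.
- have [_ le] := HB j jq; apply: le_lt_trans le _.
  rewrite !exprVn -!exprM ltf_pV2 ?posrE ?exprn_gt0 // ltr_eXn2l ?ltr1n //.
  by rewrite /e; nia.
apply/existsP; exists c; apply/existsP; exists (finfun g); apply/andP; split.
  by apply/injectiveP => x y; rewrite !ffunE; exact: g_inj.
apply/forallP => x; apply/forallP => y; apply/implyP => xy; rewrite !ffunE.
by have /andP[] := g_adj x y xy.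
Qed.

(** * The Ramsey bound *)

(** One step turns [5 t + 3 s + 8] into [13 t + 8 s + 16], and three times the latter is at most
    eight times the former. *)
Lemma stage_params_growth d e k : let p := stage_params d e k in
  (3 ^ k * (5 * p.1 + 3 * p.2 + 8) <= 8 ^ k * (5 * d + 3 * e + 8))%N.
Proof.
elim: k => [|k] /=; first by rewrite !expn0 !mul1n.
move: (stage_params d e k) => [t s] /= IH.
rewrite !expnS -mulnA.
apply: leq_trans (_ : 8 * (3 ^ k * (5 * t + 3 * s + 8)) <= _)%N.
  by rewrite mulnCA [X in (_ <= X)%N]mulnCA leq_mul2l; apply/orP; right; lia.
by rewrite -mulnA leq_mul2l IH.
Qed.

Lemma square_exp_growth q : (q * q * 8 ^ q <= 128 * 9 ^ q)%N.
Proof.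
(* The added lower-order terms make the induction step reduce to [q <= q * q]. *)
suff : (8 ^ q * (q * q + 15 * q + 128) <= 128 * 9 ^ q)%N.
  by apply: leq_trans; rewrite mulnC leq_mul2l -addnA leq_addr orbT.
elim: q => [//|q IH]; rewrite !expnS.
apply: leq_trans (_ : 9 * (8 ^ q * (q * q + 15 * q + 128)) <= _)%N; last first.
  by rewrite [X in (_ <= X)%N]mulnCA leq_mul2l IH.
rewrite -mulnA mulnCA [X in (_ <= X)%N]mulnCA leq_mul2l.
by apply/orP; right; nia.
Qed.

Lemma leq_exp_up_log m : (0 < m)%N -> (2 ^ up_log 2 m <= 2 * m)%N.
Proof.
case: m => [//|[|m]] _; first by rewrite up_log1.
have := @up_log_gtn 2 m.+2 isT isT.
rewrite -{2}(prednK (_ : 0 < up_log 2 m.+2)%N) ?up_log_gt0 // expnS leq_mul2l /=.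
exact: ltnW.
Qed.

Lemma exponent_bound (R : realFieldType) (q r d t E L U X : nat) (delta : R) :
  0 < delta -> delta <= 1 -> (0 < q)%N -> (0 < d)%N ->
  q%:R / delta <= r%:R -> r%:R <= 2 * q%:R / delta ->
  (3 ^ q * (5 * t + 3 * E) <= 8 ^ q * (25 * r * d))%N ->
  (L <= U %/ r + 1)%N ->
  (X = (6 * E + 5) * q.*2 + (45 * q * t + L) * q + (45 * q * t + L) + 1)%N ->
  X%:R <= 2 ^+ 18 * q%:R * 3 ^+ q * d%:R / delta + 2 * delta * U%:R.
Proof.
move=> de0 de1 q0 d0 ler rle growth leL ->.
have q1 : 1 <= q%:R :> R by rewrite ler1n.
set a : R := d%:R / delta; set G : R := (8 / 3) ^+ q.
have a1 : 1 <= a.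
  by rewrite ler_pdivlMr // mul1r (le_trans de1) // ler1n.
have G1 : 1 <= G by rewrite exprn_ege1 //; lra.
have qG : q%:R * q%:R * G <= 128 * 3 ^+ q :> R.
  rewrite /G expr_div_n mulrA ler_pdivrMr ?exprn_gt0 // -[leRHS]mulrA -exprMn.
  have -> : 3 * 3 = 9%:R :> R by ring.
  by rewrite -!natrX -!natrM ler_nat square_exp_growth.
have r0 : 0 < r%:R :> R.
  by apply: lt_le_trans ler; rewrite divr_gt0 // ltr0n.
have rd : r%:R * d%:R <= 2 * q%:R * a.
  by rewrite /a mulrA mulrAC ler_wpM2r.
have tE : 5 * t%:R + 3 * E%:R <= 50 * (q%:R * a * G) :> R.
  have : 3 ^+ q * (5 * t%:R + 3 * E%:R) <= 8 ^+ q * (25 * (r%:R * d%:R)) :> R.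
    by move: growth; rewrite -(ler_nat R) !(natrM, natrD, natrX) -!mulrA.
  rewrite -ler_pdivlMl ?exprn_gt0 // => /le_trans; apply.
  have -> m : (3 ^+ q)^-1 * (8 ^+ q * m) = G * m.
    by rewrite /G expr_div_n mulrA [_^-1 * _]mulrC.
  have : 25 * (r%:R * d%:R) <= 50 * (q%:R * a) by lra.
  move/(ler_wpM2l (le_trans ler01 G1)); lra.
(* Here [r >= q / delta] enters: the [q] losses of [L] bits cost only [delta * U], up to
   rounding. *)
have qL : q%:R * L%:R <= delta * U%:R + q%:R :> R.
  have : L%:R <= U%:R / r%:R + 1 :> R.
    apply: le_trans (_ : (U %/ r)%:R + 1 <= _).
      by rewrite natr1 -addn1 ler_nat.
    by rewrite lerD2r ler_pdivlMr // -natrM ler_nat leq_divM.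
  move=> leLr; apply: le_trans (ler_wpM2l (ler0n _ _) leLr) _.
  rewrite mulrDr mulr1 lerD2r mulrA ler_pdivrMr // mulrAC.
  by rewrite ler_wpM2r // -ler_pdivrMl // mulrC.
(* [W] dominates every term of the exponent but those in [U]; its [q ^ 2 (8 / 3) ^ q] is absorbed by
   [128 * 3 ^ q]. *)
set W := q%:R * q%:R * q%:R * a * G.
have W_ge x y : 0 <= x -> x <= y -> x * (a * G) <= y * (a * G) :> R.
  by move=> x0 xy; rewrite ler_wpM2r // mulr_ge0 // (le_trans ler01).
have aG1 : 1 <= a * G by rewrite mulr_ege1.
have qq1 : q%:R <= q%:R * q%:R :> R by rewrite ler_peMl.
have qqq1 : q%:R * q%:R <= q%:R * q%:R * q%:R :> R.
  by rewrite ler_peMr // mulr_ge0.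
have WE : W = q%:R * q%:R * q%:R * (a * G) by rewrite /W mulrA.
have qW : q%:R <= W.
  rewrite WE (le_trans _ (_ : q%:R * (a * G) <= _)) ?ler_peMr // W_ge //.
  exact: le_trans qqq1.
have qEW : 3 * (q%:R * E%:R) <= 50 * W :> R.
  apply: le_trans (_ : q%:R * (50 * (q%:R * a * G)) <= _).
    rewrite mulrCA ler_wpM2l // (le_trans _ tE) // lerDr mulr_ge0 //.
  have := W_ge _ _ (mulr_ge0 (ler0n _ q) (ler0n _ q)) qqq1; rewrite -WE; lra.
have qtW : 5 * (q%:R * q%:R * t%:R) <= 50 * W :> R.
  apply: le_trans (_ : q%:R * q%:R * (50 * (q%:R * a * G)) <= _).
    rewrite mulrCA ler_wpM2l ?mulr_ge0 // (le_trans _ tE) // lerDl mulr_ge0 //.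
  rewrite WE; lra.
have WG : W <= 128 * (q%:R * 3 ^+ q * a).
  have -> : W = q%:R * a * (q%:R * q%:R * G) by rewrite /W; ring.
  have -> : 128 * (q%:R * 3 ^+ q * a) = q%:R * a * (128 * 3 ^+ q) :> R by ring.
  by rewrite ler_wpM2l // mulr_ge0 // (le_trans ler01).
have -> : 2 ^+ 18 * q%:R * 3 ^+ q * d%:R / delta =
    2 ^+ 11 * (128 * (q%:R * 3 ^+ q * a)) :> R.
  by rewrite /a; ring.
have {}WG : 1129 * W <= 2 ^+ 11 * (128 * (q%:R * 3 ^+ q * a)).
  have W0 : 0 <= W by apply: le_trans qW.
  apply: le_trans (ler_wpM2l (exprn_ge0 11 (ler0n R 2)) WG).
  by rewrite ler_wpM2r // -natrX ler_nat.
apply: le_trans (_ : 1129 * W + 2 * delta * U%:R <= _); last by rewrite lerD2r.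
rewrite !(natrD, natrM) -addnn natrD.
have qqt : q%:R * t%:R <= q%:R * q%:R * t%:R :> R by rewrite ler_wpM2r.
have LqL : L%:R <= q%:R * L%:R :> R by rewrite ler_peMl.
lra.
Qed.

Theorem theorem2p1 (R : realType) :
  exists c : R, forall delta : R, 0 < delta -> delta <= 1 ->
  forall (d Delta q n : nat) (H : sgraph),
    (0 < d)%N -> (0 < Delta)%N -> (0 < n)%N ->
    degenerate d Delta H -> chromatic_number H = q -> #|H| = n ->
    (ramsey_number H)%:R <
      2 `^ (c * q%:R * 3 ^+ q * d%:R / delta)
      * Delta%:R `^ (c * delta) * n%:R.
Proof.
(* Twice the [2 ^+ 18] of [exponent_bound]: as [w >= 3], doubling covers one unit for strictness and
   two for rounding [Delta] up to a power of 2. *)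
exists (2 ^+ 19) => delta de0 de1 d Delta q n H d0 D0 n0 degH chiH cardH.
have Hcol : colorable H q by rewrite -chiH /chromatic_number; case: ex_minnP.
have q0 : (0 < q)%N.
  rewrite lt0n; apply/negP => /eqP q00; move: n0; rewrite -cardH.
  case/card_gt0P => x _; have /existsP[f _] := Hcol.
  by case: (f x) => i; rewrite q00.
pose r := (Num.truncn (q%:R / delta : R)).+1.
have q1 : 1 <= q%:R / delta.
  by rewrite ler_pdivlMr // mul1r (le_trans de1) // ler1n.
have ler : q%:R / delta <= r%:R by rewrite ltW // truncnS_gt.
have rle : r%:R <= 2 * q%:R / delta.
  have : r%:R <= q%:R / delta + 1.
    by rewrite /r -natr1 lerD2r truncn_le (le_trans ler01).
  lra.
pose e := ((r + 2) * d + 1)%N.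
pose U := up_log 2 Delta; pose L := (U %/ r + 1)%N.
have [t tE] : exists t, t = (stage_params d e q).1 by eexists.
have [s sE] : exists s, s = (stage_params d e q).2 by eexists.
pose b := (45 * q * t + L)%N.
pose X := ((6 * s + 5) * q.*2 + b * q + b + 1)%N.
have ramseyX : (ramsey_number H <= 2 ^ X * n)%N.
  rewrite /X sE -cardH.
  apply: (@ramsey_number_leq H d Delta q r b) => //; rewrite ?cardH //.
    apply: leq_trans (_ : 2 ^ U <= _)%N; first exact: up_logP.
    rewrite leq_exp2l //.
    rewrite -/U /b mulnDl (leq_trans _ (leq_addl _ _)) // /L addn1 ltnW //.
    exact: ltn_ceil.
  by rewrite -/e -tE leq_addr.
have growth : (3 ^ q * (5 * t + 3 * s) <= 8 ^ q * (25 * r * d))%N.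
  have := stage_params_growth d e q; rewrite /= -tE -sE => le.
  apply: leq_trans (leq_trans le _); first by rewrite leq_mul2l leq_addr orbT.
  (* [5 d + 3 e + 8] equals [3 r d + 11 d + 11], at most [25 r d]. *)
  by rewrite leq_mul2l; apply/orP; right; rewrite /e /r; nia.
have := exponent_bound de0 de1 q0 d0 ler rle growth (leqnn _) (erefl X).
set w := 2 ^+ 18 * _ * _ * _ / _ => leX.
have w1 : 3 <= w.
  have q3d1 : 1 <= q%:R * 3 ^+ q * (d%:R / delta).
    by rewrite !mulr_ege1 ?exprn_ege1 ?ler1n ?invf_ge1.
  have -> : w = 2 ^+ 18 * (q%:R * 3 ^+ q * (d%:R / delta)) by rewrite /w !mulrA.
  apply: le_trans (ler_peMr _ q3d1); last exact: exprn_ge0.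
  apply: (@le_trans _ _ (2 ^+ 2)); rewrite ?ler_eXn2l ?ltr1n //.
  by rewrite -natrX ler_nat.
have D1 : 1 <= Delta%:R :> R by rewrite ler1n.
apply: (@lt_le_trans _ _ (2 `^ (X%:R + 1) * n%:R)).
  rewrite natr1 powR_mulrn // -natrX -natrM ltr_nat (leq_ltn_trans ramseyX) //.
  by rewrite ltn_pmul2r // ltn_exp2l.
rewrite ler_wpM2r //.
apply: (@le_trans _ _ (2 `^ (w + 1 + 2 * delta * U%:R))).
  by apply: ler_powR; [rewrite ler1n | lra].
rewrite powRD ?pnatr_eq0 ?implybT //.
have U_le : 2 `^ (2 * delta * U%:R) <= 2 `^ 2 * Delta%:R `^ (2 ^+ 19 * delta).
  rewrite (mulrC _ U%:R) (powRrM 2) (powR_mulrn U) // -natrX.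
  apply: (@le_trans _ _ ((2 * Delta)%:R `^ (2 * delta))).
    apply: (@ge0_ler_powR R (2 * delta)); rewrite ?nnegrE ?ler0n //.
      by rewrite mulr_ge0 // ltW.
    by rewrite ler_nat leq_exp_up_log.
  rewrite natrM powRM // ler_pM ?powR_ge0 //.
    by apply: ler_powR; [rewrite ler1n | lra].
  apply: ler_powR => //; rewrite ler_wpM2r ?(ltW de0) //.
  by rewrite -[leLHS]expr1 ler_eXn2l ?ltr1n.
apply: le_trans (ler_wpM2l (powR_ge0 _ _) U_le) _.
rewrite mulrA ler_wpM2r ?powR_ge0 // -powRD ?pnatr_eq0 ?implybT //.
apply: ler_powR; first by rewrite ler1n.
have -> : 2 ^+ 19 * q%:R * 3 ^+ q * d%:R / delta = 2 * w.
  by rewrite /w exprS -!mulrA.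
lra.
Qed.
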